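(* Consider a solution of a mirror system of four particles (as defined in the context) with $\Delta=\mathcal{E}^2-\mu\ge 0$. Then $x_1^n\to-\infty$ and $x_4^n\to+\infty$ as $n\to\pm\infty$ (i.e. both as $n\to+\infty$ and as $n\to-\infty$), and the energy of particle 2 and the energy of particle 3 tend to zero as time goes to infinity, both in the future and in the past (i.e. $E_2^n\to 0$ and $E_3^n\to 0$ as $n\to+\infty$ and as $n\to-\infty$).
   Context: Units are such that the speed of light is $1$. A particle on the real line has energy $E\in\mathbb{R}\setminus\{0\}$, momentum $P\in\mathbb{R}$, velocity $v=P/E$ and squared mass $E^2-P^2$; energies may have either sign. For each particle put $\sigma=E+P$ and $\rho=E-P$. Between collisions particles move with constant velocity. When particles $i,j$ with $v_i\ne v_j$ collide, put $s=\sigma_i+\sigma_j$, $r=\rho_i+\rho_j$; provided $sr\neq0$, the post-collision values are $\sigma_i'=\rho_i s/r$, $\rho_i'=\sigma_i r/s$, $\sigma_j'=\rho_j s/r$, $\rho_j'=\sigma_j r/s$ (total energy, total momentum and each squared mass are preserved). A mirror system consists of four particles with positions $x_1\le x_2\le x_3\le x_4$ such that at all times $x_1=-x_4$, $x_2=-x_3$, $E_1=E_4$, $P_1=-P_4$, $E_2=E_3$, $P_2=-P_3$; the squared masses are $\mu_1=\mu_4=\mu>0$ and $\mu_2=\mu_3=0$. Collisions of the pair 1-2 are simultaneous with those of the pair 3-4; particles 2 and 3 collide only at the origin, where they exchange their energies and momenta (so $E_2$ is unchanged and $P_2$ changes sign). The quantity $\mathcal{E}=E_1+E_2$ is a constant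 of the motion, and $\Delta=\mathcal{E}^2-\mu$. Solutions are assumed to be such that every collision, in the future and in the past, can be resolved by the collision rule $\sigma_i'=\rho_i s/r$, $\rho_i'=\sigma_i r/s$, $\sigma_j'=\rho_j s/r$, $\rho_j'=\sigma_j r/s$ ($sr\ne0$), and there are no multiple collisions at the same time and point (in particular $x_1<0$). The collisions between particles 1 and 2 (equivalently 3 and 4) are indexed in time order by $n\in\mathbb{Z}$: $x_j^n$ is the position of particle $j$ at the $n$-th such collision, and $E_j^n$ is the (constant) energy of particle $j$ between the $n$-th and the $(n+1)$-th such collisions. *)

(* Defs.v *)
From HB Require Import structures.
From mathcomp Require Import all_boot all_order all_algebra.
From mathcomp Require Import all_classical all_reals all_analysis.

Set Implicit Arguments.
Unset Strict Implicit.
Unset Printing Implicit Defensive.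

Import Order.TTheory GRing.Theory Num.Theory.
Import numFieldNormedType.Exports.

Local Open Scope classical_set_scope.
Local Open Scope ring_scope.

(* Position, energy and momentum of N particles as functions of time.
   Energies and momenta jump at collisions; by convention, their value at a
   collision time is the post-collision one, so that they are constant on
   intervals [a, b[ where the particle has no collision in ]a, b[. *)
Record motion (R : realType) (N : nat) := Motion {
  position : 'I_N -> R -> R;
  energy : 'I_N -> R -> R;
  momentum : 'I_N -> R -> R }.

Section Dynamics.
Variables (R : realType) (N : nat) (S : motion R N).
Implicit Types (i j k : 'I_N) (a b t u : R).

Definition velocity i t : R := momentum S i t / energy S i t.
Definition sigma i t : R := energy S i t + momentum S i t.
Definition rho i t : R := energy S i t - momentum S i t.

Definition collides i t : Prop :=
  exists j, j != i /\ position S i t = position S j t.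

(* The collision of i and j turns their values at time u (before) into their
   values at time t (after). *)
Definition collision_rule i j u t : Prop :=
  let s := sigma i u + sigma j u in
  let r := rho i u + rho j u in
  [/\ s * r != 0,
      sigma i t = rho i u * s / r /\ rho i t = sigma i u * r / s &
      sigma j t = rho j u * s / r /\ rho j t = sigma j u * r / s].

Record is_solution : Prop := IsSolution {
  energy_neq0 : forall i t, energy S i t != 0;
  (* collision times do not accumulate *)
  collisions_isolated :
    forall t, \forall u \near t^', forall i, ~ collides i u;
  free_motion : forall i a b, a < b ->
    (forall u, a < u < b -> ~ collides i u) ->
    (forall u, a <= u < b ->
       energy S i u = energy S i a /\ momentum S i u = momentum S i a) /\
    (forall u, a <= u <= b ->
       position S i u = position S i a + velocity i a * (u - a));
  (* at any time u < t such that i and j do not collide in ]u, t[, they have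
     their pre-collision values for the collision at time t *)
  collisions_resolved : forall i j t u, i != j ->
    position S i t = position S j t -> u < t ->
    (forall w, u < w < t -> ~ collides i w /\ ~ collides j w) ->
    velocity i u != velocity j u ->
    collision_rule i j u t;
  no_multiple_collision : forall i j k t, i != j -> j != k -> i != k ->
    ~ (position S i t = position S j t /\ position S j t = position S k t) }.

End Dynamics.

Definition p1 : 'I_4 := @Ordinal 4 0 isT.
Definition p2 : 'I_4 := @Ordinal 4 1 isT.
Definition p3 : 'I_4 := @Ordinal 4 2 isT.
Definition p4 : 'I_4 := @Ordinal 4 3 isT.

Section Mirror.
Variables (R : realType) (mu : R) (S : motion R 4).

Definition squared_mass (i : 'I_4) (t : R) : R :=
  energy S i t ^+ 2 - momentum S i t ^+ 2.

(* That particles 2 and 3 collide only at the origin, exchanging energies and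
   momenta, follows from the symmetry and from [collisions_resolved]. *)
Record mirror_solution : Prop := MirrorSolution {
  mirror_is_solution : is_solution S;
  mirror_ordered : forall t,
    [/\ position S p1 t <= position S p2 t,
        position S p2 t <= position S p3 t &
        position S p3 t <= position S p4 t];
  mirror_14 : forall t,
    [/\ position S p1 t = - position S p4 t,
        energy S p1 t = energy S p4 t &
        momentum S p1 t = - momentum S p4 t];
  mirror_23 : forall t,
    [/\ position S p2 t = - position S p3 t,
        energy S p2 t = energy S p3 t &
        momentum S p2 t = - momentum S p3 t];
  mirror_mu_gt0 : 0 < mu;
  mirror_mass14 : forall t, squared_mass p1 t = mu /\ squared_mass p4 t = mu;
  mirror_mass23 : forall t, squared_mass p2 t = 0 /\ squared_mass p3 t = 0 }.

(* This is a constant of the motion, hence may be read off at any time t. *)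
Definition mirror_energy (t : R) : R := energy S p1 t + energy S p2 t.

Definition mirror_Delta (t : R) : R := mirror_energy t ^+ 2 - mu.

(* tau enumerates in time order the collision times of the pair 1-2. *)
Definition collision_times12 (tau : int -> R) : Prop :=
  (forall m n : int, m < n -> tau m < tau n) /\
  (forall t : R, position S p1 t = position S p2 t <-> exists n, t = tau n).

Definition position_at (tau : int -> R) (j : 'I_4) (n : int) : R :=
  position S j (tau n).

(* By the convention on post-collision values, this is the energy of particle j
   between the n-th and the (n+1)-th collision of the pair 1-2; it is constant
   there because a collision of the pair 2-3 does not change energies. *)
Definition energy_after (tau : int -> R) (j : 'I_4) (n : int) : R :=
  energy S j (tau n).

End Mirror.

(* Main.v *)
Require Import Defs.
From HB Require Import structures.
From mathcomp Require Import all_boot all_order all_algebra.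
From mathcomp Require Import all_classical all_reals all_analysis.
From mathcomp Require Import ring lra zify.

Set Implicit Arguments.
Unset Strict Implicit.
Unset Printing Implicit Defensive.

Import Order.TTheory GRing.Theory Num.Theory.
Import numFieldNormedType.Exports.

Local Open Scope classical_set_scope.
Local Open Scope ring_scope.

(* Between two consecutive collisions of the pair 1-2, particle 2 goes to the
   origin and back at speed 1.  With a = - x_1 > 0 and rho = E_1 - P_1 read at
   the n-th collision, and q = rho / sqrt mu, c = \mathcal{E} / sqrt mu, this
   gives
     q_{n+1} = 2c - 1/q_n,  a_{n+1} = a_n q_n^2,
     2 E_2^n / sqrt mu = q_{n+1} - q_n.
   Put q_n = y_{n+1} / y_n; then y_{n+2} = 2c y_{n+1} - y_n, a_n is a multiple
   of y_n^2, and q_{n+1} - q_n = - Q / (y_n y_{n+1}) where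
   Q = y_{n+1}^2 - 2c y_n y_{n+1} + y_n^2 is a constant, nonzero because E_2 is.
   So everything reduces to |y_n| --> +oo, which holds when c^2 >= 1, i.e.
   Delta >= 0, since the characteristic roots are then real. *)

(** * Lower bounds for second-order linear recurrences with real characteristic roots *)

Lemma bernoulli_ineq (R : realType) (m : R) (n : nat) :
  0 <= m -> 1 + n%:R * (m - 1) <= m ^+ n.
Proof.
move=> m0; elim: n => [|n IH]; first by rewrite mul0r addr0.
rewrite exprS -natr1; have := ler_wpM2l m0 IH.
have : 0 <= n%:R * (m - 1) ^+ 2 by rewrite mulr_ge0 ?sqr_ge0.
nra.
Qed.

(** An AM-GM bound: the exponents 1, 3, ..., 2n-1 have mean n. In the induction, the step divided by
    [m ^+ n] is Bernoulli's inequality at exponent [n.+1]. *)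
Lemma sum_odd_powers_ge (R : realType) (m : R) (n : nat) :
  1 <= m -> n%:R * m ^+ n <= m * \sum_(k < n) m ^+ k.*2.
Proof.
move=> m1; have m0 : 0 <= m by apply: le_trans m1.
elim: n => [|n IH]; first by rewrite big_ord0 mulr0 mul0r.
rewrite big_ord_recr /= mulrDr -addnn exprD exprS.
have B := bernoulli_ineq n.+1 m0.
have mn : 0 <= m ^+ n by exact: exprn_ge0.
have := ler_wpM2l mn B; move: IH; rewrite exprS -natr1; nra.
Qed.

(** The two real roots [c + d] and [c - d] have product 1, so they cannot both have absolute value
    below 1. *)
Lemma exists_large_root (R : realType) (c : R) : 1 <= c ^+ 2 ->
  exists2 l : R, l ^+ 2 - 2 * c * l + 1 = 0 & 1 <= `|l|.
Proof.
move=> c1; set d := Num.sqrt (c ^+ 2 - 1).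
have dE : d ^+ 2 = c ^+ 2 - 1 by rewrite sqr_sqrtr // subr_ge0.
have [h|h] := leP 1 `|c + d|; [exists (c + d) | exists (c - d)] => //; try by nra.
have: `|c + d| * `|c - d| = 1.
  by rewrite -normrM (_ : _ * _ = 1) ?normr1 //; nra.
by have := normr_ge0 (c - d); have := normr_ge0 (c + d); nra.
Qed.

(** Linear growth is all that is claimed, so that the double root, [c ^+ 2 = 1], and distinct roots
    are treated at once. Factoring the recurrence through its two roots leaves two first-order
    recurrences, solved in [yw] and [yl]. *)
Lemma linear_recurrence_lower_bound (R : realType) (c : R) (y : nat -> R) :
  1 <= c ^+ 2 -> (forall n, y n.+2 = 2 * c * y n.+1 - y n) ->
  y 1%N ^+ 2 - 2 * c * y 0%N * y 1%N + y 0%N ^+ 2 != 0 ->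
  exists2 d : R, 0 < d & forall n, n%:R * d - `|y 0%N| <= `|y n|.
Proof.
move=> c1 yS Q0; have [l lE l1] := exists_large_root c1.
have l0 : l != 0 by rewrite -normr_gt0 (lt_le_trans _ l1).
(* [2 * c - l] is the other root, that is [l^-1]. The quadratic form assumed nonzero factors as [(y
   1 - l * y 0) * (y 1 - (2 * c - l) * y 0)], hence [w != 0]. *)
pose w := y 1%N - (2 * c - l) * y 0%N.
have w0 : w != 0.
  apply: contra_neq Q0 => w0; have y1 : y 1%N = (2 * c - l) * y 0%N.
    by apply/eqP; rewrite -subr_eq0 -/w w0.
  rewrite y1; transitivity (y 0%N ^+ 2 * (l ^+ 2 - 2 * c * l + 1)); first by ring.
  by rewrite lE mulr0.
have yw n : y n.+1 - (2 * c - l) * y n = l ^+ n * w.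
  elim: n => [|n IH]; first by rewrite expr0 mul1r.
  rewrite exprS -mulrA -IH yS.
  by apply/eqP; rewrite -subr_eq0; apply/eqP;
    transitivity ( (l ^+ 2 - 2 * c * l + 1) * - y n); [ring|rewrite lE mul0r].
(* Multiplying [yw] by [l ^+ n.+1] makes it telescope, since [l * (2 * c - l) = 1]. *)
have yl n : l ^+ n * y n = y 0%N + w * (l * \sum_(k < n) l ^+ k.*2).
  elim: n => [|n IH]; first by rewrite big_ord0 !mulr0 addr0 mul1r.
  rewrite big_ord_recr /= !mulrDr addrA -IH.
  rewrite (_ : y n.+1 = (2 * c - l) * y n + l ^+ n * w); last by rewrite -yw; ring.
  rewrite -addnn exprD exprS.
  transitivity (l ^+ n * y n + w * (l * (l ^+ n * l ^+ n))
     - (l ^+ 2 - 2 * c * l + 1) * (l ^+ n * y n)); first by ring.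
  by rewrite lE mul0r subr0.
exists `|w|; first by rewrite normr_gt0.
move=> n; have ln : 1 <= `|l| ^+ n by exact: exprn_ege1.
have := congr1 Num.norm (yl n); rewrite normrM normrX => e.
have : `|w * (l * \sum_(k < n) l ^+ k.*2)| - `|y 0%N| <= `|l| ^+ n * `|y n|.
  by rewrite e [y 0%N + _]addrC; exact: lerB_normD.
rewrite normrM normrM.
have -> : `|\sum_(k < n) l ^+ k.*2| = \sum_(k < n) `|l| ^+ k.*2.
  rewrite ger0_norm.
    by apply: eq_bigr => k _; rewrite -muln2 mulnC !exprM real_normK ?num_real.
  by apply: sumr_ge0 => k _; rewrite -muln2 mulnC exprM exprn_ge0 ?sqr_ge0.
have := sum_odd_powers_ge n l1.
have : 0 <= `|w| by []. have : 0 <= `|y 0%N| by [].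
set W := `|w|; set Y := `|y 0%N|; set z := `|y n|; set L := _ ^+ _.
set T := (X in _ <= X -> _) => Y0 W0 h1 h2.
(* The sum is at least [n * L] in absolute value, and [Y <= L * Y]; the common factor [L] then
   cancels. *)
rewrite -(ler_pM2l (_ : 0 < L)); last by apply: lt_le_trans ln.
apply: le_trans h2; have := ler_wpM2l W0 h1; have : Y <= L * Y by rewrite ler_peMl.
lra.
Qed.

Lemma near_ge_linear_lower_bound (R : realType) (d e A : R) (z : nat -> R) :
  0 < d -> (forall n, n%:R * d - e <= z n) -> \forall n \near \oo, A <= z n.
Proof.
move=> d0 zlb; near=> n; apply: le_trans (zlb n).
rewrite lerBrDr -ler_pdivrMr//; near: n; exact: nbhs_infty_ger.
Unshelve. all: by end_near. Qed.

(** * The Riccati recurrence, forwards and backwards in the index *)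

(** The condition [q 1%N != q 0%N] says that [q] does not start at a fixed point of the Riccati map;
    by [qdiff] this is the nonvanishing of the invariant [Q]. *)
Lemma riccati_growth (R : realType) (c : R) (q a : nat -> R) :
  1 <= c ^+ 2 -> (forall k, q k != 0) -> (forall k, q k.+1 = 2 * c - (q k)^-1) ->
  q 1%N != q 0%N -> 0 < a 0%N -> (forall k, a k.+1 = a k * q k ^+ 2) ->
  a k @[k --> \oo] --> +oo /\ q k.+1 - q k @[k --> \oo] --> (0 : R).
Proof.
move=> c1 q0 qS q10 a0 aS.
pose y n := \prod_(i < n) q i.
have yS n : y n.+1 = y n * q n by rewrite /y big_ord_recr.
have y0 : y 0%N = 1 by rewrite /y big_ord0.
have yneq0 n : y n != 0 by apply/prodf_neq0 => i _.
have yrec n : y n.+2 = 2 * c * y n.+1 - y n.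
  by rewrite yS qS yS; have := q0 n; move=> ?; field.
have aE n : a n = a 0%N * y n ^+ 2.
  elim: n => [|n IH]; first by rewrite y0 expr1n mulr1.
  by rewrite aS IH yS; ring.
pose Q n := y n.+1 ^+ 2 - 2 * c * y n * y n.+1 + y n ^+ 2.
have Qcst n : Q n = Q 0%N.
  by elim: n => // n <-; rewrite /Q yrec; ring.
have qdiff n : q n.+1 - q n = - Q 0%N / (y n * y n.+1).
  by rewrite -(Qcst n) /Q qS yS; have := q0 n; have := yneq0 n => ? ?; field; apply/andP.
have Q0 : Q 0%N != 0.
  apply: contra_neq q10 => Q0; apply/eqP; rewrite -subr_eq0 qdiff Q0; apply/eqP; ring.
have [d d0 ylb] := linear_recurrence_lower_bound c1 yrec Q0.
have ynear A : \forall n \near \oo, A <= `|y n| by apply: near_ge_linear_lower_bound ylb.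
have ynearS A : \forall n \near \oo, A <= `|y n.+1|.
  apply: (near_ge_linear_lower_bound (d := d) (e := `|y 0%N|)) => // n.
  by apply: le_trans (ylb n.+1); rewrite lerD2r ler_pM2r// ler_nat.
split.
  apply/cvgryPge => A; near=> n; rewrite aE.
  have h1 : 1 <= `|y n| by near: n.
  have : A / a 0%N <= `|y n| by near: n.
  rewrite ler_pdivrMr// -[y n ^+ 2]real_normK ?num_real// => h2.
  by apply: (le_trans h2); rewrite mulrC ler_pM2l// expr2 ler_peMl.
apply/cvgr0Pnorm_le => e e0; near=> n.
have h1 : 1 <= `|y n.+1| by near: n.
have : `|Q 0%N| / e <= `|y n| by near: n.
rewrite qdiff normrM normrN normfV normrM ler_pdivrMr// => h2.
rewrite ler_pdivrMr ?mulr_gt0 ?normr_gt0//; apply: (le_trans h2).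
by rewrite mulrC ler_pM2l// ler_peMr.
Unshelve. all: by end_near. Qed.

Lemma riccati_growth_both (R : realType) (c : R) (q a : int -> R) :
  1 <= c ^+ 2 -> (forall n, q n != 0) ->
  (forall n : int, q (n + 1) = 2 * c - (q n)^-1) -> (forall n, q (n + 1) != q n) ->
  0 < a 0 -> (forall n, a (n + 1) = a n * q n ^+ 2) ->
  [/\ a k%:Z @[k --> \oo] --> +oo, a (- k%:Z) @[k --> \oo] --> +oo,
      q (k%:Z + 1) - q k%:Z @[k --> \oo] --> (0 : R) &
      q (- k%:Z + 1) - q (- k%:Z) @[k --> \oo] --> (0 : R)].
Proof.
move=> c1 q0 qS qne a0 aS.
have intS (k : nat) : k.+1%:Z = k%:Z + 1 by rewrite -addn1.
have [aoo qoo] : a k%:Z @[k --> \oo] --> +oo /\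
    q k.+1%:Z - q k%:Z @[k --> \oo] --> (0 : R).
  apply: (@riccati_growth _ c (fun k => q k%:Z)) => // [k||k].
  - by rewrite intS qS.
  - exact: (qne 0).
  - by rewrite intS aS.
(* Read backwards in n, the recurrence keeps its form for 1/q. *)
have negS (k : nat) : - k%:Z = - k.+1%:Z + 1 by rewrite intS; ring.
have qV (k : nat) : q (- k%:Z) = 2 * c - (q (- k.+1%:Z))^-1 by rewrite {1}negS qS.
have [aNoo qNoo] : a (- k%:Z) @[k --> \oo] --> +oo /\
    (q (- k.+2%:Z))^-1 - (q (- k.+1%:Z))^-1 @[k --> \oo] --> (0 : R).
  apply: (@riccati_growth _ c (fun k => (q (- k.+1%:Z))^-1)) => // [k|k||k].
  - by rewrite invr_neq0.
  - by rewrite invrK (qV k.+1); ring.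
  - have := qne (- 2%:Z); rewrite (_ : - 2%:Z + 1 = - 1%:Z)//.
    by apply: contra_neq => /invr_inj.
  - by rewrite (negS k) aS -mulrA -exprMn divff ?expr1n ?mulr1.
split=> //; first by move: qoo; under eq_fun do rewrite intS.
(* By [qV] at [k] and at [k.+1], the difference of inverses in [qNoo] at [k] equals
   [q (- k%:Z) - q (- k.+1%:Z)], which is the wanted difference at [k.+1]; hence the shift by
   one. *)
rewrite -(cvg_shiftn 1); apply: cvg_trans qNoo; apply: near_eq_cvg; near=> k => /=.
by rewrite addn1 -negS; have := qV k; have := qV k.+1; lra.
Unshelve. all: by end_near. Qed.

(** * Consequences of the isolation of collision times *)

Section Solution.
Variables (R : realType) (N : nat) (S : motion R N).
Hypothesis solS : is_solution S.

Lemma isolated_ball (t : R) : exists2 e, 0 < e &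
  forall u i, u != t -> `|u - t| < e -> ~ collides S i u.
Proof.
have /nbhs_ballP[e /= e0 he] := collisions_isolated solS t.
by exists e => // u i ut ute; apply: he => //=; rewrite /ball/= distrC.
Qed.

Lemma collision_free_after (t b : R) : t < b ->
  exists2 c, t < c < b & forall u i, t < u < c -> ~ collides S i u.
Proof.
move=> tb; have [e e0 he] := isolated_ball t.
exists (t + Num.min e (b - t) / 2).
  have : 0 < Num.min e (b - t) by rewrite lt_min e0 subr_gt0.
  have : Num.min e (b - t) <= b - t by rewrite ge_min lexx orbT.
  lra.
move=> u i tu; apply: he; first by apply/eqP; lra.
rewrite gtr0_norm; last lra.
have : Num.min e (b - t) <= e by rewrite ge_min lexx.
have : 0 < Num.min e (b - t) by rewrite lt_min e0 subr_gt0.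
lra.
Qed.

(** The infimum of the later collision times of [i] is attained: one of them lies within the
    isolation radius of the infimum, so it is the infimum. *)
Lemma first_collision (i : 'I_N) (t u : R) : t < u -> collides S i u ->
  exists s, [/\ t < s <= u, collides S i s &
    forall w, t < w < s -> ~ collides S i w].
Proof.
move=> tu iu; pose A := [set w : R | t < w /\ collides S i w].
have lbA : lbound A t by move=> w [/ltW].
have hA : has_inf A by split; [exists u | exists t].
have infA := ge_inf hA.2.
exists (inf A).
have [e e0 he] := isolated_ball (inf A).
have [w Aw wlt] := inf_adherent e0 hA.
have wE : w = inf A.
  apply/eqP/negP => /negP wne; apply: (he w i wne) Aw.2.
  by have := infA _ Aw; rewrite -subr_ge0 => h; rewrite ger0_norm//; lra.
rewrite -wE in infA *; split; [|exact: Aw.2|].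
  by rewrite Aw.1 infA.
by move=> z /andP[tz zw] iz; have := infA z (conj tz iz); rewrite leNgt zw.
Qed.

(** Near the limit the only possible collision time is the limit itself, so the sequence would be
    eventually constant. *)
Lemma collisions_no_accumulation (f : nat -> R) (l : R) : injective f ->
  (forall k, exists i, collides S i (f k)) -> ~ (f k @[k --> \oo] --> l).
Proof.
move=> finj fcol fl; have [e e0 he] := isolated_ball l.
have [M _ hM] : \forall k \near \oo, `|l - f k| < e by move/cvgr_dist_lt: fl; apply.
have fE k : (M <= k)%N -> f k = l.
  move=> Mk; apply/eqP/negP => /negP fkl; have [i] := fcol k.
  by apply: he fkl _; rewrite distrC; exact: hM.
by have /finj/eqP := etrans (fE M (leqnn _)) (esym (fE _ (leqnSn _))); rewrite ltn_eqF.
Qed.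

End Solution.

(** * One cycle of the mirror system, from one 1-2 collision to the next *)

Section Mirror.
Variables (R : realType) (mu : R) (S : motion R 4).
Hypothesis hS : mirror_solution mu S.

Local Notation x i := (position S i).
Local Notation E i := (energy S i).
Local Notation P i := (momentum S i).
Let solS := mirror_is_solution hS.

Lemma ord4_cases (j : 'I_4) : [\/ j = p1, j = p2, j = p3 | j = p4].
Proof.
by case: j => [[|[|[|[|//]]]]] h; [apply: Or41|apply: Or42|apply: Or43|apply: Or44];
  apply: val_inj.
Qed.

(** Order and symmetry give [x p1 t <= 0]; equality would put all four particles at the origin, a
    multiple collision. *)
Lemma mirror_pos_lt0 t : x p1 t < 0.
Proof.
have [h12 h23 h34] := mirror_ordered hS t; have [h14 _ _] := mirror_14 hS t.
rewrite lt_neqAle; apply/andP; split; last lra.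
apply/eqP => x0; apply: (@no_multiple_collision _ _ _ solS p1 p2 p3 t) => //; split; lra.
Qed.

Lemma collides1 t : collides S p1 t -> x p1 t = x p2 t.
Proof.
move=> [j [jne xj]]; have := mirror_pos_lt0 t.
have [h12 h23 h34] := mirror_ordered hS t; have [h14 _ _] := mirror_14 hS t.
have [h _ _] := mirror_23 hS t.
by case: (ord4_cases j) => jE; rewrite jE in xj jne => //; lra.
Qed.

Lemma collides2 t : collides S p2 t -> x p1 t = x p2 t \/ x p2 t = 0.
Proof.
move=> [j [jne xj]]; have := mirror_pos_lt0 t.
have [h12 h23 h34] := mirror_ordered hS t; have [h14 _ _] := mirror_14 hS t.
have [h _ _] := mirror_23 hS t => ?.
by case: (ord4_cases j) => jE; rewrite jE in xj jne => //; [left|right|right]; lra.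
Qed.

Lemma collides3 t : collides S p3 t -> collides S p2 t.
Proof.
move=> [j [jne xj]]; have := mirror_pos_lt0 t.
have [h12 h23 h34] := mirror_ordered hS t; have [h14 _ _] := mirror_14 hS t.
have [h _ _] := mirror_23 hS t => ?.
case: (ord4_cases j) => jE; rewrite jE in xj jne => //; try lra; first by exists p3.
by exists p1; split => //; lra.
Qed.

Lemma collides12 t : x p1 t = x p2 t -> collides S p1 t /\ collides S p2 t.
Proof. by move=> h; split; [exists p2|exists p1]. Qed.

Lemma velocity1_lt1 t : -1 < velocity S p1 t < 1.
Proof.
rewrite -ltr_norml; have E0 := energy_neq0 solS p1 t; have m0 := mirror_mu_gt0 hS.
have [] := mirror_mass14 hS t; rewrite /squared_mass => m _.
rewrite -(@ltr_pXn2r _ 2) ?nnegrE// expr1n real_normK ?num_real//.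
rewrite /velocity expr_div_n ltr_pdivrMr ?exprn_even_gt0//; lra.
Qed.

Lemma momentum2_cases t : P p2 t = E p2 t \/ P p2 t = - E p2 t.
Proof.
have [] := mirror_mass23 hS t; rewrite /squared_mass => /eqP.
by rewrite subr_eq0 eq_sym eqf_sqr => /orP[]/eqP -> _; [left|right].
Qed.

Lemma velocity2_right t : P p2 t = E p2 t -> velocity S p2 t = 1.
Proof. by rewrite /velocity => ->; rewrite divff ?(energy_neq0 solS). Qed.

Lemma velocity2_left t : P p2 t = - E p2 t -> velocity S p2 t = -1.
Proof. by rewrite /velocity => ->; rewrite mulNr divff ?(energy_neq0 solS). Qed.

Lemma free_motion1 a b : a < b -> (forall u, a < u < b -> x p1 u <> x p2 u) ->
  (forall u, a <= u < b -> E p1 u = E p1 a /\ P p1 u = P p1 a) /\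
  (forall u, a <= u <= b -> x p1 u = x p1 a + velocity S p1 a * (u - a)).
Proof.
by move=> ab h; apply: (free_motion solS) => // u /h hu; move/collides1.
Qed.

Lemma free_motion2 a b : a < b -> (forall u, a < u < b -> ~ collides S p2 u) ->
  (forall u, a <= u < b -> E p2 u = E p2 a /\ P p2 u = P p2 a) /\
  (forall u, a <= u <= b -> x p2 u = x p2 a + velocity S p2 a * (u - a)).
Proof. exact: (free_motion solS). Qed.

(** Momenta at a collision time are post-collision. A particle 2 leaving to the left at speed 1
    would overtake particle 1, which is slower than light, and break the ordering. *)
Lemma momentum2_after12 t : x p1 t = x p2 t -> P p2 t = E p2 t.
Proof.
move=> x12; have [//|/velocity2_left v2] := momentum2_cases t.
have tt1 : t < t + 1 by rewrite ltrDl.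
have [c /andP[tc _] free] := collision_free_after solS tt1.
have [_ /(_ c)] := free_motion1 tc (fun u hu h => free u p1 hu (collides12 h).1).
have [_ /(_ c)] := free_motion2 tc (fun u => free u p2).
rewrite v2 lexx (ltW tc) => /(_ isT) x2c /(_ isT) x1c.
have [h _ _] := mirror_ordered hS c; have /andP[v1 _] := velocity1_lt1 t.
by nra.
Qed.

(** Leaving the origin to the right, particle 2 would pass its mirror image, particle 3. *)
Lemma momentum2_after23 t : x p2 t = 0 -> P p2 t = - E p2 t.
Proof.
move=> x20; have [/velocity2_right v2|//] := momentum2_cases t.
have tt1 : t < t + 1 by rewrite ltrDl.
have [c /andP[tc _] free] := collision_free_after solS tt1.
have [_ /(_ c)] := free_motion2 tc (fun u => free u p2).
rewrite v2 lexx (ltW tc) => /(_ isT) x2c.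
have [_ h _] := mirror_ordered hS c; have [h' _ _] := mirror_23 hS c.
lra.
Qed.

(** By symmetry both totals in the collision rule equal [2 * E p2 u], so the rule just swaps [sigma]
    and [rho] of particle 2. It applies because the velocities are opposite and of absolute value
    1. *)
Lemma energy2_at23 u s : u < s -> x p2 s = 0 ->
  (forall w, u < w < s -> ~ collides S p2 w) -> E p2 s = E p2 u.
Proof.
move=> us x2s free; have [x23 _ _] := mirror_23 hS s; have [_ E23 P23] := mirror_23 hS u.
have E0 := energy_neq0 solS p2 u; have E30 := energy_neq0 solS p3 u.
have [] : collision_rule S p2 p3 u s.
  apply: (collisions_resolved solS) => //; first by lra.
    by move=> w /free hw; split=> // /collides3.
  apply/eqP => v23; have : velocity S p2 u = 0.
    have : velocity S p2 u = - velocity S p3 u by rewrite /velocity -E23 P23 mulNr.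
    lra.
  by case: (momentum2_cases u) => [/velocity2_right|/velocity2_left] ->; lra.
rewrite /sigma /rho -E23 (_ : P p3 u = - P p2 u); last lra.
rewrite (_ : E p2 u + P p2 u + (E p2 u + - P p2 u) = 2 * E p2 u); last ring.
rewrite (_ : E p2 u - P p2 u + (E p2 u - - P p2 u) = 2 * E p2 u); last ring.
have E20 : 2 * E p2 u != 0 by rewrite mulf_neq0.
by rewrite !mulfK// => _ [s2 r2] _; lra.
Qed.

(** Particle 2 runs to the origin, is reflected there at a time [s] with its energy unchanged, and
    runs back to particle 1. *)
Lemma between_collisions12 t t' : t < t' -> x p1 t = x p2 t -> x p1 t' = x p2 t' ->
  (forall u, t < u < t' -> x p1 u <> x p2 u) ->
  [/\ forall u, t <= u <= t' -> mirror_energy S u = mirror_energy S t,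
      x p1 t' = x p1 t * (rho S p1 t / sigma S p1 t) &
      rho S p1 t' = rho S p1 t + 2 * E p2 t].
Proof.
move=> tt' x12 x12' free12; have x1t := mirror_pos_lt0 t.
have /andP[v1gt v1lt] := velocity1_lt1 t.
have [c1 f1] := free_motion1 tt' free12.
have Pt := momentum2_after12 x12.
(* Moving right at speed 1 without collision, particle 2 only gains on particle 1 and cannot be
   level with it at [t']. *)
have no_free a : t <= a < t' -> P p2 a = E p2 a ->
    (forall w, a < w < t' -> ~ collides S p2 w) -> False.
  move=> /andP[ta at'] /velocity2_right v2 free_motion2'.
  have [_ /(_ t')] := free_motion2 at' free_motion2'; have := f1 t'; have := f1 a.
  rewrite v2 !lexx ta (ltW at') (ltW tt') => /(_ isT) f1a /(_ isT) f1t' /(_ isT) f2t'.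
  have [h _ _] := mirror_ordered hS a; nra.
have [u0 [hu0 col0]] : exists u, t < u < t' /\ collides S p2 u.
  apply: contrapT => none; apply: (no_free t) => //; first by rewrite lexx.
  by move=> w hw cw; apply: none; exists w.
move: hu0 => /andP[tu0 u0t'].
have [s [/andP[ts su0] cols frees]] := first_collision solS tu0 col0.
have st' : s < t' by apply: le_lt_trans u0t'.
have x2s : x p2 s = 0.
  by have [/free12|//] := collides2 cols; rewrite ts st' => /(_ isT).
have Ps := momentum2_after23 x2s.
have [c2 f2] := free_motion2 ts frees.
have E2s := energy2_at23 ts x2s frees.
(* A further collision before [t'] could only be at the origin, which particle 2 has left for the
   left. *)
have frees' w : s < w < t' -> ~ collides S p2 w.
  move=> /andP[sw wt'] cw.
  have [z [/andP[sz zw] cz freez]] := first_collision solS sw cw.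
  have [|x2z] := collides2 cz; first by apply: free12; apply/andP; split; lra.
  have [_ /(_ z)] := free_motion2 sz freez.
  rewrite (velocity2_left Ps) x2z x2s lexx (ltW sz) => /(_ isT); lra.
have [c2' f2'] := free_motion2 st' frees'.
have [E1s P1s] : E p1 s = E p1 t /\ P p1 s = P p1 t by apply: c1; rewrite st' ltW.
have s1E : sigma S p1 s = sigma S p1 t by rewrite /sigma E1s P1s.
have r1E : rho S p1 s = rho S p1 t by rewrite /rho E1s P1s.
have [] : collision_rule S p1 p2 s t'.
  apply: (collisions_resolved solS) => //.
    move=> w hw; split; last exact: frees'.
    by move=> /collides1; apply: free12; apply/andP; split; lra.
  rewrite (velocity2_left Ps) /velocity E1s P1s -/(velocity S p1 t).
  by apply/eqP; lra.
(* A left-moving massless particle has [sigma = 0], so the total [s] of the collision rule is just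
   [sigma S p1 t] and the new [rho] of particle 1 is the total [r]. *)
have s2 : sigma S p2 s = 0 by rewrite /sigma Ps subrr.
have r2 : rho S p2 s = 2 * E p2 t by rewrite /rho Ps E2s; ring.
rewrite s1E r1E s2 r2 addr0 => sr0 [s1' r1'] [s2' r2'].
move: sr0; rewrite mulf_eq0 negb_or => /andP[sn0 rn0].
have r1E' : rho S p1 t' = rho S p1 t + 2 * E p2 t by rewrite r1'; field.
have ME : mirror_energy S t' = mirror_energy S t.
  have : sigma S p1 t' + sigma S p2 t' = sigma S p1 t by rewrite s1' s2'; field.
  have : rho S p2 t' = 0 by rewrite r2' !mul0r.
  by rewrite /mirror_energy; move: r1E'; rewrite /sigma /rho; lra.
split => //.
  move=> u /andP[tu]; rewrite le_eqVlt => /orP[/eqP -> //|ut'].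
  have := c1 u; rewrite /mirror_energy tu ut' => /(_ isT)[-> _].
  have [us|su] := ltP u s.
    by have := c2 u; rewrite tu us => /(_ isT)[-> _].
  by have := c2' u; rewrite su ut' E2s => /(_ isT)[-> _].
(* Particle 2 takes [- x p1 t] to reach the origin and [- x p1 t'] to return. Substituting the total
   time into the motion of particle 1 gives [h], and [(1 - v) / (1 + v) = rho / sigma]. *)
have := f1 t'; have := f2' t'; have := f2 s.
rewrite !lexx (ltW ts) (ltW st') (ltW tt') => /(_ isT) e1 /(_ isT) e2 /(_ isT) e3.
rewrite x2s -x12 (velocity2_right Pt) in e1.
rewrite x2s (velocity2_left Ps) -x12' in e2.
have E0 := energy_neq0 solS p1 t.
have se : sigma S p1 t + rho S p1 t != 0.
  by rewrite /sigma /rho (_ : _ + _ = 2 * E p1 t) ?mulf_neq0//; ring.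
have vE : velocity S p1 t = (sigma S p1 t - rho S p1 t) / (sigma S p1 t + rho S p1 t).
  by move: se; rewrite /velocity /sigma /rho => se; field; apply/andP.
have h : (1 + velocity S p1 t) * x p1 t' = (1 - velocity S p1 t) * x p1 t by nra.
have v0 : 1 + velocity S p1 t != 0 by apply/eqP; lra.
apply: (mulfI v0); rewrite h vE; field; exact/andP.
Qed.
End Mirror.

(** * The collision times [tau] exhaust the time axis *)

Section CollisionTimes.
Variables (R : realType) (mu : R) (S : motion R 4) (tau : int -> R).
Hypotheses (hS : mirror_solution mu S) (htau : collision_times12 S tau).

Lemma tau_le (m n : int) : (tau m <= tau n) = (m <= n).
Proof.
have [mn|nm] := leP m n; last by apply/negbTE; rewrite -ltNge htau.1.
by move: mn; rewrite le_eqVlt => /orP[/eqP->|/htau.1/ltW//]; rewrite lexx.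
Qed.

Lemma tau_lt (m n : int) : (tau m < tau n) = (m < n).
Proof. by rewrite !ltNge tau_le. Qed.

Lemma tau_inj : injective tau.
Proof. by move=> m n mn; apply/eqP; rewrite eq_le -!tau_le mn lexx. Qed.

Lemma tau_collision n : position S p1 (tau n) = position S p2 (tau n).
Proof. by apply/htau.2; exists n. Qed.

Lemma no_collision_between n u :
  tau n < u < tau (n + 1) -> position S p1 u <> position S p2 u.
Proof. by move=> + /htau.2[m um]; rewrite um !tau_lt; lia. Qed.

Lemma tau_no_accumulation (f : nat -> int) (l : R) : injective f ->
  ~ (tau (f k) @[k --> \oo] --> l).
Proof.
move=> finj; apply: (collisions_no_accumulation (mirror_is_solution hS)).
  by move=> i j /tau_inj/finj.
by move=> k; exists p1; exact: (collides12 (tau_collision (f k))).1.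
Qed.

(** Otherwise [tau] would be bounded and monotone in one direction, hence convergent, and collision
    times would accumulate. *)
Lemma tau_unbounded t : (exists n, tau n <= t) /\ (exists n, t < tau n).
Proof.
split; apply: contrapT => none.
  apply: (@tau_no_accumulation (fun k => - k%:Z) (inf (range (fun k : nat => tau (- k%:Z))))).
    by move=> i j; lia.
  apply: nonincreasing_cvgn; first by move=> i j ij; rewrite tau_le; lia.
  exists t => _ [k _ <-]; rewrite leNgt; apply/negP => h; apply: none.
  by exists (- k%:Z); exact: ltW.
apply: (@tau_no_accumulation (fun k => k%:Z) (sup (range (fun k : nat => tau k%:Z)))).
  by move=> i j; lia.
apply: nondecreasing_cvgn; first by move=> i j ij; rewrite tau_le; lia.
exists t => _ [k _ <-]; rewrite leNgt; apply/negP => h; apply: none.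
by exists k%:Z.
Qed.

Lemma tau_locate t : exists n, tau n <= t < tau (n + 1).
Proof.
have [[m mt] [n tn]] := tau_unbounded t; apply: contrapT => none.
suff below (k : nat) : tau (m + k%:Z) <= t.
  have mn : m < n by rewrite -tau_lt (le_lt_trans mt).
  by have := below `|n - m|%N; rewrite leNgt (_ : m + _ = n) ?tn//; lia.
elim: k => [|k IH]; first by rewrite addr0.
rewrite leNgt; apply/negP => h; apply: none; exists (m + k%:Z).
by rewrite IH /= (_ : m + k%:Z + 1 = m + k.+1%:Z)//; lia.
Qed.

Lemma mirror_step n :
  [/\ forall u, tau n <= u <= tau (n + 1) -> mirror_energy S u = mirror_energy S (tau n),
      position S p1 (tau (n + 1)) =
        position S p1 (tau n) * (rho S p1 (tau n) / sigma S p1 (tau n)) &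
      rho S p1 (tau (n + 1)) = rho S p1 (tau n) + 2 * energy S p2 (tau n)].
Proof.
apply: (between_collisions12 hS); try exact: tau_collision; last exact: no_collision_between.
by rewrite tau_lt; lia.
Qed.

(** Constancy on each cycle extends to all times because the cycles cover the line. This carries the
    sign condition on Delta, read at an arbitrary time, to the collision times. *)
Lemma mirror_energy_const t u : mirror_energy S t = mirror_energy S u.
Proof.
have stepE n : mirror_energy S (tau (n + 1)) = mirror_energy S (tau n).
  have [h _ _] := mirror_step n; apply: h; rewrite lexx tau_le andbT; lia.
have tauE n : mirror_energy S (tau n) = mirror_energy S (tau 0).
  elim/int_rec: n => // n IH; first by rewrite -addn1 PoszD stepE.
  by rewrite -IH -(stepE (- n.+1%:Z)); congr (mirror_energy _ (tau _)); lia.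
suff h s : mirror_energy S s = mirror_energy S (tau 0) by rewrite !h.
have [n /andP[ns sn]] := tau_locate s; have [h _ _] := mirror_step n.
by rewrite h ?tauE// ns ltW.
Qed.

End CollisionTimes.

(** * Translation of the mirror dynamics into the Riccati recurrence *)

Theorem proposition13 (R : realType) (mu : R) (S : motion R 4)
    (tau : int -> R) (t0 : R)
    (hS : mirror_solution mu S)
    (htau : collision_times12 S tau)
    (hDelta : 0 <= mirror_Delta mu S t0) :
  [/\ position_at S tau p1 k%:Z @[k --> \oo] --> -oo,
      position_at S tau p1 (- k%:Z) @[k --> \oo] --> -oo,
      position_at S tau p4 k%:Z @[k --> \oo] --> +oo &
      position_at S tau p4 (- k%:Z) @[k --> \oo] --> +oo] /\
  [/\ energy_after S tau p2 k%:Z @[k --> \oo] --> (0 : R),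
      energy_after S tau p2 (- k%:Z) @[k --> \oo] --> (0 : R),
      energy_after S tau p3 k%:Z @[k --> \oo] --> (0 : R) &
      energy_after S tau p3 (- k%:Z) @[k --> \oo] --> (0 : R)].
Proof.
have m0 := mirror_mu_gt0 hS.
pose r := Num.sqrt mu; have r0 : r != 0 by rewrite sqrtr_eq0 -ltNge.
have rE : r ^+ 2 = mu by rewrite sqr_sqrtr// ltW.
pose q n := rho S p1 (tau n) / r.
pose a n := - position S p1 (tau n).
pose c := mirror_energy S t0 / r.
(* The mass shell in light-cone form: it makes both factors nonzero and gives
   [(q n)^-1 = sigma S p1 (tau n) / r]. *)
have sr n : sigma S p1 (tau n) * rho S p1 (tau n) = mu.
  by have [<- _] := mirror_mass14 hS (tau n); rewrite /sigma /rho /squared_mass; ring.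
have [s0 rho0] : (forall n, sigma S p1 (tau n) != 0) /\ (forall n, rho S p1 (tau n) != 0).
  by split=> n; apply: contraTneq m0 => e; rewrite -(sr n) e ?mul0r ?mulr0 ltxx.
have qdiff n : q (n + 1) - q n = 2 / r * energy S p2 (tau n).
  by have [_ _ h] := mirror_step hS htau n; rewrite /q h; field.
have [|n|n|n||n|a1 a2 e1 e2] := @riccati_growth_both R c q a.
- rewrite /c expr_div_n rE ler_pdivlMr// mul1r.
  by move: hDelta; rewrite /mirror_Delta subr_ge0.
- by rewrite mulf_neq0 ?invr_neq0.
- have -> : q (n + 1) = q n + 2 / r * energy S p2 (tau n) by rewrite -qdiff; ring.
  have -> : c = (sigma S p1 (tau n) + rho S p1 (tau n) + 2 * energy S p2 (tau n)) / (2 * r).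
    rewrite /c (mirror_energy_const hS htau t0 (tau n)) /mirror_energy /sigma /rho.
    by field.
  have -> : (q n)^-1 = sigma S p1 (tau n) / r.
    rewrite /q invf_div; apply/eqP; rewrite eqr_div// -expr2 rE sr//.
  by rewrite /q; field.
(* Consecutive values of [q] differ because the energy of particle 2 never vanishes. *)
- by rewrite -subr_eq0 qdiff !mulf_neq0 ?invr_neq0// (energy_neq0 (mirror_is_solution hS)).
- by rewrite /a oppr_gt0 (mirror_pos_lt0 hS).
(* On the mass shell the position ratio [rho / sigma] is [rho ^+ 2 / mu], that is [q n ^+ 2]. *)
- have [_ h _] := mirror_step hS htau n; rewrite /a h /q expr_div_n rE -(sr n).
  by field; rewrite s0 rho0.
have x4E n : position_at S tau p4 n = a n.
  by have [h _ _] := mirror_14 hS (tau n); rewrite /position_at /a h opprK.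
have E2E n : energy_after S tau p2 n = r / 2 * (q (n + 1) - q n).
  by rewrite qdiff /energy_after; field.
have E3E n : energy_after S tau p3 n = r / 2 * (q (n + 1) - q n).
  by rewrite -E2E /energy_after; have [_ -> _] := mirror_23 hS (tau n).
have lim0 (f : nat -> R) : f k @[k --> \oo] --> (0 : R) ->
    r / 2 * f k @[k --> \oo] --> (0 : R).
  by move=> f0; rewrite -[X in _ --> X](mulr0 (r / 2)); apply: cvgM => //; exact: cvg_cst.
split; split.
- exact/cvgNry.
- exact/cvgNry.
- by under eq_fun do rewrite x4E.
- by under eq_fun do rewrite x4E.
- by under eq_fun do rewrite E2E; exact: lim0 e1.
- by under eq_fun do rewrite E2E; exact: lim0 e2.
- by under eq_fun do rewrite E3E; exact: lim0 e1.
- by under eq_fun do rewrite E3E; exact: lim0 e2.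
Qed.
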